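(* For any tournament $T$ of order $n$, $\rho'(T)\le \lfloor 7n/36\rfloor+3$.
   Context: All tournaments are finite. A tournament is a complete oriented graph: a digraph $T$ with vertex set $V(T)$ and arc set $A(T)$ (no loops) such that for all distinct $u,v\in V(T)$ exactly one of $uv$, $vu$ belongs to $A(T)$; its order is $|V(T)|\ge 1$. $Aut(T)$ denotes the automorphism group of $T$; the identity is the trivial automorphism. An arc labeling of $T$ with two labels is a total function $\phi:A(T)\to L$ with $|L|=2$ (not required to be surjective, so a label class may be empty). An automorphism $\sigma\in Aut(T)$ preserves $\phi$ if $\phi(uv)=\phi(\sigma(u)\sigma(v))$ for every arc $uv\in A(T)$. The labeling $\phi$ is 2-distinguishing if no nontrivial automorphism preserves it. A distinguishing arc class is one of the two sets of arcs having the same label under a 2-distinguishing arc labeling. $\rho'(T)$ denotes the minimum size of a distinguishing arc class of $T$, over all 2-distinguishing arc labelings of $T$. (Every finite tournament has a 2-distinguishing arc labeling, so $\rho'(T)$ is defined.) *)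

(* Defs.v *)
From HB Require Import structures.
From mathcomp Require Import all_boot all_fingroup.

Set Implicit Arguments.
Unset Strict Implicit.
Unset Printing Implicit Defensive.

Record tournament := Tournament {
  vertex :> finType;
  arc : rel vertex;
  order_gt0 : 0 < #|vertex|;
  arc_irr : irreflexive arc;
  arc_xor : forall u v : vertex, u != v -> arc u v (+) arc v u }.

Definition arcs (T : tournament) := {e : T * T | arc e.1 e.2}.

Definition is_aut (T : tournament) (s : {perm T}) :=
  [forall u, forall v, arc (s u) (s v) == arc u v].

Definition aut (T : tournament) := {s : {perm T} | is_aut s}.

Lemma aut_arc (T : tournament) (s : aut T) (e : arcs T) :
  arc (val s (val e).1) (val s (val e).2).
Proof. by rewrite (eqP (forallP (forallP (valP s) _) _)) (valP e). Qed.

Definition arc_image (T : tournament) (s : aut T) (e : arcs T) : arcs T :=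
  exist (fun e : T * T => arc e.1 e.2)
    (val s (val e).1, val s (val e).2) (aut_arc s e).

(* The two-element label set is bool; a labeling need not be surjective, so one
   of its two arc classes may be empty. *)
Notation labeling T := {ffun arcs T -> bool}.

Definition preserves (T : tournament) (s : aut T) (phi : labeling T) :=
  [forall e, phi e == phi (arc_image s e)].

Definition distinguishing (T : tournament) (phi : labeling T) :=
  [forall s : aut T, preserves s phi ==> (val s == 1%g)].

Definition arc_class (T : tournament) (phi : labeling T) (l : bool)
  : {set arcs T} := [set e | phi e == l].

Definition distinguishing_class (T : tournament) (S : {set arcs T}) :=
  [exists phi : labeling T, distinguishing phi &&
    [exists l : bool, S == arc_class phi l]].

(* Labeling the arcs of a Hamiltonian path differently from all other arcs
   is distinguishing, so the minimum defining rho' is taken over a nonempty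
   set. *)
Lemma distinguishing_exists (T : tournament) :
  exists phi : labeling T, distinguishing phi.
Proof.
pose r : rel T := fun x y => (x == y) || arc x y.
have r_tot : total r.
  move=> x y; rewrite /r; have [-> | nxy] := eqVneq x y; first by [].
  by have := arc_xor nxy; case: (arc x y); case: (arc y x); rewrite ?orbT.
pose p := sort r (enum T).
have p_sorted : sorted r p by apply: sort_sorted.
have p_uniq : uniq p by rewrite sort_uniq enum_uniq.
have p_in x : x \in p by rewrite mem_sort mem_enum.
pose ix x := index x p.
have ix_inj : injective ix.
  by move=> x y /(congr1 (nth x p)); rewrite !nth_index.
pose phi : labeling T := [ffun e => ix (val e).2 == (ix (val e).1).+1].
exists phi; apply/forallP => s; apply/implyP => /forallP s_phi.
have [/card0_eq T0 | /card_gt0P[x0 _]] := posnP #|T|.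
  by apply/eqP/permP => x; have := T0 x.
pose pt i := nth x0 p i.
have ix_pt i : i < size p -> ix (pt i) = i by move=> lt_i; apply: index_uniq.
have step i : i.+1 < size p -> ix (val s (pt i.+1)) = (ix (val s (pt i))).+1.
  move=> lt_i; have lt_i' := ltnW lt_i.
  have a_i : arc (pt i) (pt i.+1).
    have /orP[/eqP eq_i | //] : r (pt i) (pt i.+1).
      by apply/(sortedP x0).
    by have := congr1 ix eq_i; rewrite !ix_pt // => /n_Sn.
  pose e : arcs T := exist (fun e : T * T => arc e.1 e.2) (pt i, pt i.+1) a_i.
  have := s_phi e; rewrite !ffunE /= !ix_pt // eqxx => /eqP h.
  by apply/eqP; rewrite -h.
have shift i : i < size p -> ix (val s (pt i)) = ix (val s (pt 0)) + i.
  elim: i => [|i IHi] lt_i; first by rewrite addn0.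
  by rewrite step // IHi ?addnS // ltnW.
have p_gt0 : 0 < size p by apply: leq_ltn_trans (_ : ix x0 < _); rewrite ?index_mem.
have s0 : ix (val s (pt 0)) = 0.
  have lt_last : (size p).-1 < size p by rewrite prednK.
  have : ix (val s (pt (size p).-1)) < size p by rewrite index_mem.
  rewrite shift // -[X in _ < X]prednK // ltnS -[X in _ <= X]add0n leq_add2r.
  by rewrite leqn0 => /eqP.
apply/eqP/permP => x; rewrite perm1; apply: ix_inj.
have lt_x : ix x < size p by rewrite index_mem.
have -> : val s x = val s (pt (ix x)) by rewrite /pt nth_index.
by rewrite shift // s0.
Qed.

Lemma distinguishing_class_exists (T : tournament) :
  exists k, [exists S : {set arcs T}, distinguishing_class S && (#|S| == k)].
Proof.
have [phi phi_dist] := distinguishing_exists T.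
exists #|arc_class phi true|; apply/existsP; exists (arc_class phi true).
rewrite eqxx andbT; apply/existsP; exists phi; rewrite phi_dist.
by apply/existsP; exists true.
Qed.

Definition rho' (T : tournament) : nat :=
  ex_minn (distinguishing_class_exists T).

(* Main.v *)
Require Import Defs.
From mathcomp Require Import all_boot all_fingroup.
From mathcomp Require Import zify.

(** The bound comes from two facts about the automorphism group of a
    tournament, both resting on the remark that an orbit of a group of
    automorphisms is a regular tournament, hence has odd order
    ([card_orbit_nbrs], [odd_orbit]).

    The first fact ([pinned_by_third]) is that some set B of at most n/3
    vertices is fixed pointwise by no nontrivial automorphism.  It is proved for
    every invariant set X of every group G of automorphisms, by induction on X.
    Fixing a vertex v separates its out-neighbours from its in-neighbours, so
    in an orbit of order 2m + 1 one vertex plus the bases of two invariant sets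
    of order m suffice; the roundings of the induction hypothesis absorb the
    extra vertex unless 3 divides m, and in that case a closer look at the
    stabilizer of v gains what is missing.

    The second fact ([rigid_matching]) is that an invariant set W of even order
    has a perfect matching such that the elements of G that preserve it fix W
    pointwise.  Since orbits are odd, W has an even number of them.  Take two,
    join one vertex of the first to one vertex of the second, and match
    everything else inside the first orbit, inside the second orbit, or
    outside both.  The chosen edge is the only one between the two
    orbits, so its ends are fixed; the three remaining parts are even and
    invariant under the stabilizer of both ends, and induction applies.

    Enlarge B, by one vertex if its order is odd, to a set W of even order, and
    give one label to the arcs of T that join two vertices matched in W.  An
    automorphism that preserves this labeling preserves W and its matching, so
    it fixes W, hence B, and is trivial.  The class has |W|/2 arcs, so that
    2 rho'(T) <= n/3 + 1, which is stronger than the bound 7n/36 + 3. *)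

Set Implicit Arguments.
Unset Strict Implicit.
Unset Printing Implicit Defensive.

Local Open Scope group_scope.

(* The arc relation of a tournament, rather than the arcs of a cyclic
   sequence. *)
Local Notation arc := Defs.arc.

(** * Automorphisms, neighbourhoods and orbits *)

Definition automorphisms (T : tournament) : {set {perm T}} :=
  [set s | is_aut s].

Lemma automorphismP (T : tournament) (s : {perm T}) :
  reflect (forall u v, arc (s u) (s v) = arc u v) (s \in automorphisms T).
Proof.
rewrite inE; apply: (iffP forallP) => [s_aut u v | s_aut u].
  by apply/eqP; move/forallP: (s_aut u).
by apply/forallP => v; rewrite s_aut.
Qed.

Lemma automorphisms_group_set (T : tournament) : group_set (automorphisms T).
Proof.
apply/group_setP; split=> [|s t /automorphismP s_aut /automorphismP t_aut].
  by apply/automorphismP => u v; rewrite !perm1.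
by apply/automorphismP => u v; rewrite !permM t_aut s_aut.
Qed.

Canonical automorphisms_group (T : tournament) :=
  group (automorphisms_group_set T).

Lemma arcxx (T : tournament) (v : T) : arc v v = false.
Proof. exact: arc_irr. Qed.

Lemma arcC (T : tournament) (u v : T) : u != v -> arc v u = ~~ arc u v.
Proof. by move/arc_xor; case: (arc u v); case: (arc v u). Qed.

Definition out_nbrs (T : tournament) (v : T) : {set T} := [set u | arc v u].
Definition in_nbrs (T : tournament) (v : T) : {set T} := [set u | arc u v].

Lemma acts_stab (T : finType) (G : {group {perm T}}) (X : {set T}) (v : T) :
  [acts G, on X | 'P] -> [acts 'C_G[v | 'P], on X | 'P].
Proof. exact/subset_trans/subsetIl. Qed.

Lemma acts_nbrs (T : tournament) (G : {group {perm T}}) (v : T) :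
    G \subset automorphisms T ->
  [acts 'C_G[v | 'P], on out_nbrs v | 'P] *
  [acts 'C_G[v | 'P], on in_nbrs v | 'P].
Proof.
move=> sG; split; apply/actsP => s /setIP[/(subsetP sG)/automorphismP s_aut].
  by move/astab1P => /= s_v u; rewrite !inE -(s_aut v u) [s v]s_v.
by move/astab1P => /= s_v u; rewrite !inE -(s_aut u v) [s v]s_v.
Qed.

Lemma card_split_vertex (T : tournament) (X : {set T}) (v : T) : v \in X ->
  #|X| = (#|X :&: out_nbrs v| + #|X :&: in_nbrs v|).+1.
Proof.
move=> Xv; rewrite (cardsD1 v) Xv add1n; congr _.+1.
rewrite -(cardsID (out_nbrs v) (X :\ v)); congr (_ + _)%N; apply: eq_card => u.
  by rewrite !inE; case: eqVneq => //= ->; rewrite arcxx andbF.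
rewrite !inE; case: eqVneq => [-> | /= nuv]; first by rewrite arcxx andbF.
by rewrite andbC (arcC nuv) negbK.
Qed.

(** Both sides are constant along the orbit O, and summing either of them over
    O counts the arcs inside O.  So O induces a regular tournament. *)
Lemma card_orbit_nbrs (T : tournament) (G : {group {perm T}}) (v : T) :
    G \subset automorphisms T -> let O := orbit 'P G v in
  #|O :&: in_nbrs v| = #|O :&: out_nbrs v|.
Proof.
move=> sG O.
have OG (s : {perm T}) u : s \in G -> (s u \in O) = (u \in O).
  by move=> Gs; exact: (orbit_actr 'P%act v u Gs).
have const (e : rel T) x :
    (forall s, s \in G -> forall u w, e (s u) (s w) = e u w) ->
  x \in O -> #|O :&: [set u | e x u]| = #|O :&: [set u | e v u]|.
  move=> eG /orbitP[s Gs <-]; rewrite -[RHS](card_imset _ (@perm_inj _ s)).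
  apply: eq_card => u; rewrite -(permKV s u) mem_imset; last exact: perm_inj.
  by rewrite !inE eG // [s _ \in O]OG.
have arc_G s : s \in G -> forall u w : T, arc (s u) (s w) = arc u w.
  by move=> /(subsetP sG)/automorphismP.
have: \sum_(x in O) #|O :&: in_nbrs x| = \sum_(x in O) #|O :&: out_nbrs x|.
  transitivity (\sum_(x in O) \sum_(u in O | arc u x) 1)%N.
    by apply: eq_bigr => x _; rewrite sum1_card; apply: eq_card => u; rewrite !inE.
  rewrite (exchange_big_dep (mem O)) //=; last by move=> x u _ /andP[].
  apply: eq_bigr => u Ou; rewrite -sum1_card; apply: eq_bigl => x.
  by rewrite !inE Ou.
rewrite (eq_bigr (fun=> #|O :&: in_nbrs v|)); last first.
  move=> x; apply: (const (fun x u => arc u x)) => s Gs u w; exact: arc_G.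
rewrite [RHS](eq_bigr (fun=> #|O :&: out_nbrs v|)); last first.
  by move=> x; apply: (const (fun x u => arc x u)).
rewrite !sum_nat_const => /eqP; rewrite eqn_pmul2l => [/eqP //|].
by apply/card_gt0P; exists v; apply: orbit_refl.
Qed.

Lemma odd_orbit (T : tournament) (G : {group {perm T}}) (v : T) :
  G \subset automorphisms T -> odd #|orbit 'P G v|.
Proof.
move=> sG; rewrite (card_split_vertex (orbit_refl _ _ _)) card_orbit_nbrs //.
by rewrite /= addnn odd_double.
Qed.

(** * A third of the vertices pins a tournament *)

(** The points of [B] form a base for the action of [G] on [X]. Only the bound
    [k] is recorded, because bounds add up over a partition of [X]
    ([pinned_byID]), which is how all bases below are built. *)
Definition pinned_by (T : finType) (G : {set {perm T}}) (X : {set T})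
    (k : nat) :=
  exists2 B : {set T}, #|B| <= k &
    (B \subset X) && ('C_G(B | 'P) \subset 'C(X | 'P)).

Lemma pinned_byU (T : finType) (G : {set {perm T}}) (X Y : {set T})
    (k l : nat) :
  pinned_by G X k -> pinned_by G Y l -> pinned_by G (X :|: Y) (k + l).
Proof.
move=> [B leBk /andP[sBX fixX]] [C leCl /andP[sCY fixY]]; exists (B :|: C).
  by rewrite (leq_trans (leq_card_setU B C)) ?leq_add.
rewrite setUSS //= !astabU subsetI setIA.
rewrite (subset_trans _ fixX) ?subsetIl //= -setIA setICA.
by rewrite (subset_trans _ fixY) ?subsetIr.
Qed.

Lemma pinned_byID (T : finType) (G : {set {perm T}}) (X Y : {set T})
    (k l : nat) :
  pinned_by G (X :&: Y) k -> pinned_by G (X :\: Y) l -> pinned_by G X (k + l).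
Proof. by move=> pin1 pin2; rewrite -(setID X Y); apply: pinned_byU. Qed.

Lemma pinned_by_vertex (T : finType) (G : {set {perm T}}) (X : {set T})
    (v : T) (k : nat) :
  v \in X -> pinned_by 'C_G[v | 'P] (X :\ v) k -> pinned_by G X k.+1.
Proof.
move=> Xv [B leBk /andP[sBX fixX]]; exists (v |: B).
  by rewrite cardsU1; apply: leq_add (leq_b1 _) leBk.
rewrite subUset sub1set Xv (subset_trans sBX) ?subsetDl //=.
rewrite -(setD1K Xv) !astabU subsetI setIA (subset_trans _ fixX) // andbT.
by rewrite subIset ?subsetIr.
Qed.

Lemma pinned_by_nbrs (T : tournament) (G : {set {perm T}}) (X : {set T})
    (v : T) (k l : nat) :
  v \in X -> pinned_by 'C_G[v | 'P] (X :&: out_nbrs v) k ->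
  pinned_by 'C_G[v | 'P] (X :&: in_nbrs v) l -> pinned_by G X (k + l).+1.
Proof.
move=> Xv pin_out pin_in; apply: (pinned_by_vertex Xv).
suff -> : X :\ v = (X :&: out_nbrs v) :|: (X :&: in_nbrs v) by apply: pinned_byU.
apply/setP => u; rewrite !inE -andb_orr andbC; congr (_ && _).
case: eqVneq => [-> | nuv]; first by rewrite arcxx.
by rewrite (arcC nuv) orNb.
Qed.

Lemma leq_div3D a b c : a + b = c -> a %/ 3 + b %/ 3 <= c %/ 3.
Proof. lia. Qed.

Lemma leq_div3_half m : m %% 3 != 0 -> (m %/ 3 + m %/ 3).+1 <= (2 * m).+1 %/ 3.
Proof. lia. Qed.

Lemma leq_div3_split m y z : m %% 3 = 0 -> y + z = m -> y %% 3 != 0 ->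
  (y %/ 3 + z %/ 3 + m %/ 3).+1 <= (2 * m).+1 %/ 3.
Proof. lia. Qed.

(** The sizes of the six parts of an orbit used in [pinned_by_third_orbit].
    Since [a = c] is congruent to 1 modulo 3, the remainders of the six sizes
    modulo 3 add up to at least 5; that gain pays for two additional vertices. *)
Lemma leq_div3_six m a b c d e f : m %% 3 = 0 -> (a + c).+1 %% 3 = 0 -> a = c ->
    (a + b + (c + d)).+1 = m -> a + b + e = m -> (c + d + f).+1 = m ->
  (a %/ 3 + b %/ 3 + e %/ 3 + (c %/ 3 + d %/ 3 + f %/ 3)).+2 <= (2 * m).+1 %/ 3.
Proof. lia. Qed.

(** The orbit has order 2m + 1, where m is the common in- and out-degree.  If 3
    does not divide m, then [v] together with a third of each of its two
    neighbourhoods is few enough.  Otherwise pick an orbit Y of the stabilizer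
    of [v] among the out-neighbours of [v].  If 3 does not divide |Y|, splitting
    the out-neighbours into Y and the rest saves one vertex in the roundings.
    If it does, then |Y| = 2a + 1 with a = 1 modulo 3; splitting
    the orbit according to [v], to a vertex [y] of Y and to Y itself gives six
    parts that the stabilizer of [v] and [y] leaves invariant, two of which
    have order a, and [leq_div3_six] concludes. *)
Lemma pinned_by_third_orbit (T : tournament) (G : {group {perm T}}) (v : T) :
    let X := orbit 'P G v in G \subset automorphisms T ->
    (forall (H : {group {perm T}}) (Z : {set T}), H \subset G ->
      [acts H, on Z | 'P] -> #|Z| < #|X| -> pinned_by H Z (#|Z| %/ 3)) ->
  pinned_by G X (#|X| %/ 3).
Proof.
move=> X sG pin; have Xv : v \in X by apply: orbit_refl.
have actX : [acts G, on X | 'P] by rewrite acts_orbit ?subsetT.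
have eq_io : #|X :&: in_nbrs v| = #|X :&: out_nbrs v|.
  exact: card_orbit_nbrs.
have := card_split_vertex Xv; rewrite eq_io addnn -mul2n.
set m := #|X :&: out_nbrs v| => cardX.
have lt_mX : m < #|X| by rewrite cardX ltnS leq_pmull.
pose H := 'C_G[v | 'P]%G.
have sHG : H \subset G by apply: subsetIl.
have actH : [acts H, on X | 'P] by apply: acts_stab.
have [act_out act_in] := acts_nbrs v sG.
have actHo : [acts H, on X :&: out_nbrs v | 'P] by apply: actsI.
have actHi : [acts H, on X :&: in_nbrs v | 'P] by apply: actsI.
have pin_out k : (k + m %/ 3).+1 <= #|X| %/ 3 ->
    pinned_by H (X :&: out_nbrs v) k -> pinned_by G X (#|X| %/ 3).
  have pin_in : pinned_by H (X :&: in_nbrs v) (m %/ 3).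
    by rewrite /m -eq_io; apply: pin; rewrite // eq_io.
  move=> le_k pin_k; have [B leB pinB] := pinned_by_nbrs Xv pin_k pin_in.
  by exists B; rewrite // (leq_trans leB).
have [m_mod3 | m_mod3] := eqVneq (m %% 3) 0; last first.
  by apply: (pin_out (m %/ 3)); [rewrite cardX leq_div3_half | apply: pin].
have [m0 | m_gt0] := posnP m.
  exists set0; first by rewrite cards0.
  have eqX1 : X = [set v] by apply: card_orbit1; rewrite cardX m0.
  rewrite sub0set eqX1; apply/subsetP => s /setIP[Gs _].
  apply/astabP => _ /set1P->.
  by have := mem_orbit 'P v Gs; rewrite -/X eqX1 => /set1P.
have /card_gt0P[y Xy_vy] := m_gt0; have /setIP[Xy vy] := Xy_vy.
pose Y := orbit 'P H y.
have sYout : Y \subset X :&: out_nbrs v by rewrite acts_sub_orbit.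
have actY : [acts H, on Y | 'P] by rewrite acts_orbit ?subsetT.
have := cardsID Y (X :&: out_nbrs v); rewrite (setIidPr sYout) -/m => cardY.
have Yy : y \in Y by apply: orbit_refl.
have [Y_mod3 | Y_mod3] := eqVneq (#|Y| %% 3) 0; last first.
  apply: (pin_out (#|Y| %/ 3 + #|X :&: out_nbrs v :\: Y| %/ 3)%N).
    by rewrite cardX leq_div3_split.
  apply: (@pinned_byID _ _ _ Y).
    rewrite (setIidPr sYout); apply: pin => //.
    by rewrite (leq_ltn_trans _ lt_mX) // -cardY leq_addr.
  apply: pin; rewrite ?actsD // (leq_ltn_trans _ lt_mX) //.
  by rewrite -cardY leq_addl.
pose K := 'C_H[y | 'P]%G; pose Z := X :\ v.
have sKG : K \subset G by rewrite (subset_trans (subsetIl _ _)).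
have actZ : [acts H, on Z | 'P].
  by rewrite actsD // astabs_set1 subsetIr.
have Zy : y \in Z.
  rewrite !inE Xy andbT; apply: contraTneq vy => ->.
  by rewrite inE arcxx.
have [actKo actKi] := acts_nbrs y (subset_trans sHG sG).
have ltZ (V : {set T}) : V \subset Z -> #|V| < #|X|.
  by move=> sVZ; rewrite (cardsD1 v X) Xv ltnS subset_leq_card.
have actKv : [acts K, on out_nbrs v | 'P] by apply: acts_stab.
have actKZ : [acts K, on Z | 'P] by apply: acts_stab.
have actKY : [acts K, on Y | 'P] by apply: acts_stab.
have pinK (V : {set T}) : [acts K, on V | 'P] -> V \subset Z ->
    pinned_by K V (#|V| %/ 3).
  by move=> actV /ltZ ltVX; apply: pin.
(* Each of the two neighbourhoods of [y] splits into three invariant parts. *)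
have pin3 (W : {set T}) : [acts K, on W | 'P] ->
    pinned_by K (Z :&: W) (#|Z :&: W :&: out_nbrs v :&: Y| %/ 3 +
      #|Z :&: W :&: out_nbrs v :\: Y| %/ 3 + #|Z :&: W :\: out_nbrs v| %/ 3).
  move=> actW; have actZW : [acts K, on Z :&: W | 'P] by apply: actsI.
  have actZWv := actsI actZW actKv.
  have sZW (V U : {set T}) : V \subset Z :&: W -> U \subset V -> U \subset Z.
    by move=> sV sU; apply: (subset_trans (subset_trans sU sV)); apply: subsetIl.
  apply: (@pinned_byID _ _ _ (out_nbrs v)); last first.
    by apply: pinK; [apply: actsD | apply: sZW (subxx _) (subsetDl _ _)].
  apply: (@pinned_byID _ _ _ Y); apply: pinK.
  - exact: actsI.
  - exact: sZW (subsetIl _ _) (subsetIl _ _).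
  - exact: actsD.
  - exact: sZW (subsetIl _ _) (subsetDl _ _).
have [B leB pinB] :=
  pinned_by_vertex Xv (pinned_by_nbrs Zy (pin3 _ actKo) (pin3 _ actKi)).
(* The parts lie outside [v], which is an in-neighbour of [y]: the three parts
   of the out-neighbours of [y] have total order [m], the other three one
   less. *)
have eqZv W : Z :&: W :&: out_nbrs v = X :&: out_nbrs v :&: W.
  apply/setP => u; rewrite !inE; case: eqVneq => [-> | _]; last by rewrite andbAC.
  by rewrite arcxx !andbF.
have eqZY W : X :&: out_nbrs v :&: W :&: Y = Y :&: W.
  by rewrite setIAC (setIidPr sYout).
have cardYy := card_split_vertex Yy.
have eq_ioY := card_orbit_nbrs y (subset_trans sHG sG).
have eq_ioy : #|X :&: in_nbrs y| = #|X :&: out_nbrs y|.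
  have -> : X = orbit 'P G y by apply/esym/orbit_eqP.
  exact: card_orbit_nbrs.
have card_oy : #|X :&: out_nbrs y| = m.
  apply/eqP; rewrite -(eqn_pmul2l (isT : 0 < 2)) -eqSS -cardX.
  by rewrite (card_split_vertex Xy) eq_ioy addnn mul2n.
have nvy : v \notin out_nbrs y.
  move: vy Zy; rewrite !inE => vy /andP[nyv _].
  by rewrite (@arcC _ v y) ?vy // eq_sym.
exists B; rewrite // (leq_trans leB) // cardX; apply: leq_div3_six => //.
- by rewrite !eqZv !eqZY -cardYy.
- by rewrite !eqZv !eqZY eq_ioY.
- by rewrite !cardsID !eqZv -card_split_vertex.
- rewrite !cardsID -card_oy; apply: eq_card => u; rewrite !inE.
  by case: eqVneq nvy => [-> | _ _ //]; rewrite inE => /negPf->; rewrite !andbF.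
- rewrite !cardsID -card_oy -eq_ioy (cardsD1 v (X :&: _)) !inE Xv.
  move: vy; rewrite inE => ->.
  by rewrite add1n; congr _.+1; apply: eq_card => u; rewrite !inE andbA.
Qed.

Lemma pinned_by_third (T : tournament) (G : {group {perm T}}) (X : {set T}) :
    G \subset automorphisms T -> [acts G, on X | 'P] ->
  pinned_by G X (#|X| %/ 3).
Proof.
have [n] := ubnP #|X|; elim: n => // n IHn in G X *.
rewrite ltnS => leXn sG actX.
have pin (H : {group {perm T}}) (Z : {set T}) : H \subset G ->
    [acts H, on Z | 'P] -> #|Z| < #|X| -> pinned_by H Z (#|Z| %/ 3).
  move=> sHG actZ ltZ.
  by apply: IHn (leq_trans ltZ leXn) (subset_trans sHG sG) actZ.
have [-> | [v Xv]] := set_0Vmem X.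
  by exists set0; rewrite ?cards0 // sub0set subsetIr.
have sOX : orbit 'P G v \subset X by rewrite acts_sub_orbit.
have actO : [acts G, on orbit 'P G v | 'P] by rewrite acts_orbit ?subsetT.
have O_gt0 : 0 < #|orbit 'P G v| by apply/card_gt0P; exists v; apply: orbit_refl.
have [ltOX | ] := boolP (orbit 'P G v \proper X); last first.
  rewrite properE sOX negbK => sXO.
  have eqXO : X = orbit 'P G v by apply/eqP; rewrite eqEsubset sXO.
  rewrite [in pinned_by _ _]eqXO [in #|_|]eqXO.
  by apply: pinned_by_third_orbit => // H Z; rewrite -eqXO; apply: pin.
have := cardsID (orbit 'P G v) X; rewrite (setIidPr sOX) => cardX.
have [||B leB pinB] := @pinned_byID _ G X (orbit 'P G v)
    (#|orbit 'P G v| %/ 3) (#|X :\: orbit 'P G v| %/ 3).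
- by rewrite (setIidPr sOX); apply: pin => //; apply: proper_card.
- by apply: pin; rewrite ?actsD // -cardX -[X in X < _]add0n ltn_add2r.
by exists B; rewrite // (leq_trans leB) // leq_div3D.
Qed.

(** * A rigid perfect matching *)

(** A perfect matching of [X] is encoded by the map that exchanges the two ends
    of each edge; a permutation preserves the matching when it commutes with
    this map on [X]. *)
Definition matching (T : finType) (X : {set T}) (f : T -> T) :=
  forall x, x \in X -> [/\ f x \in X, f x != x & f (f x) = x].

(** Induction on [X]: one edge joins the orbits of [v1] and [v2], and the rest
    of the matching stays inside one orbit, inside the other, or outside both.
    The map of such a matching sends no vertex of the first orbit to the second
    one, except [v1], which a permutation commuting with it must therefore
    fix. *)
Lemma rigid_matching (T : tournament) (G : {group {perm T}}) (X : {set T}) :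
    G \subset automorphisms T -> [acts G, on X | 'P] -> ~~ odd #|X| ->
  exists2 f, matching X f &
    forall s, s \in G -> {in X, forall x, f (s x) = s (f x)} -> s \in 'C(X | 'P).
Proof.
have [n] := ubnP #|X|; elim: n => // n IHn in G X *.
rewrite ltnS => leXn sG actX evX.
have [X0 | [v1 Xv1]] := set_0Vmem X.
  exists id => [x | s _ _]; first by rewrite X0 inE.
  by apply/astabP => x; rewrite X0 inE.
pose O1 := orbit 'P G v1.
have sO1X : O1 \subset X by rewrite acts_sub_orbit.
have actO v : [acts G, on orbit 'P G v | 'P] by rewrite acts_orbit ?subsetT.
have odd_XO1 : odd #|X :\: O1|.
  by rewrite cardsD (setIidPr sO1X) oddB ?subset_leq_card // (negPf evX) odd_orbit.
have /card_gt0P[v2 XO1v2] : 0 < #|X :\: O1| by case: #|_| odd_XO1.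
pose O2 := orbit 'P G v2.
have O2v2 : v2 \in O2 by apply: orbit_refl.
have O1v1 : v1 \in O1 by apply: orbit_refl.
have actO1 : [acts G, on O1 | 'P] by apply: actO.
have actO2 : [acts G, on O2 | 'P] by apply: actO.
have sO2XO1 : O2 \subset X :\: O1 by rewrite acts_sub_orbit // actsD.
have disj x : x \in O2 -> x \notin O1.
  by move/(subsetP sO2XO1); rewrite inE => /andP[].
have sO2X : O2 \subset X by apply: subset_trans sO2XO1 (subsetDl _ _).
(* The stabilizer of the two ends of the edge. *)
have [K memK] : {K : {group {perm T}} |
    forall s : {perm T}, (s \in K) = [&& s \in G, s v1 == v1 & s v2 == v2]}.
  exists ('C_('C_G[v1 | 'P])[v2 | 'P])%G => s.
  apply/setIP/and3P => [[/setIP[-> /astab1P s1] /astab1P s2] | [Gs /eqP s1 /eqP s2]].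
    by split=> //; apply/eqP.
  by split; [apply/setIP; split=> // |]; apply/astab1P.
have sKG : K \subset G by apply/subsetP => s; rewrite memK => /andP[].
have actK Z : [acts G, on Z | 'P] -> [acts K, on Z | 'P].
  exact: subset_trans sKG.
have actK1 : [acts K, on O1 :\ v1 | 'P].
  apply: actsD; [exact: actK | rewrite astabs_set1].
  by apply/subsetP => s; rewrite memK => /and3P[_ s1 s2]; apply/astab1P/eqP.
have actK2 : [acts K, on O2 :\ v2 | 'P].
  apply: actsD; [exact: actK | rewrite astabs_set1].
  by apply/subsetP => s; rewrite memK => /and3P[_ s1 s2]; apply/astab1P/eqP.
have actK3 : [acts K, on X :\: O1 :\: O2 | 'P] by rewrite !actsD ?actK.
have IH (Z : {set T}) : [acts K, on Z | 'P] -> Z \subset X :\ v1 -> ~~ odd #|Z| ->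
   exists2 f, matching Z f &
     forall s, s \in K -> {in Z, forall x, f (s x) = s (f x)} -> s \in 'C(Z | 'P).
  move=> actZ sZX evZ; apply: IHn => //; last exact: subset_trans sG.
  by rewrite (leq_trans _ leXn) // (cardsD1 v1 X) Xv1 ltnS subset_leq_card.
have evD1 v (O : {set T}) : v \in O -> odd #|O| -> ~~ odd #|O :\ v|.
  by move=> Ov; rewrite (cardsD1 v O) Ov.
have [||| f1 f1M f1_rigid] := IH (O1 :\ v1).
- exact: actK1.
- exact: setSD.
- exact: evD1 (odd_orbit _ sG).
have [||| f2 f2M f2_rigid] := IH (O2 :\ v2).
- exact: actK2.
- apply/subsetP => x /setD1P[_ O2x]; rewrite !inE (subsetP sO2X) // andbT.
  by apply: contraTneq (disj _ O2x) => ->; rewrite O1v1.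
- exact: evD1 (odd_orbit _ sG).
have [||| f3 f3M f3_rigid] := IH (X :\: O1 :\: O2).
- exact: actK3.
- apply/subsetP => x /setDP[/setDP[Xx O1x] _]; rewrite !inE Xx andbT.
  by apply: contraNneq O1x => ->.
- rewrite cardsD (setIidPr sO2XO1) oddB ?subset_leq_card // odd_XO1.
  by rewrite odd_orbit.
pose f x := if x == v1 then v2 else if x == v2 then v1 else
  if x \in O1 then f1 x else if x \in O2 then f2 x else f3 x.
have fv1 : f v1 = v2 by rewrite /f eqxx.
have n21 : v2 != v1 by apply: contraTneq (disj _ O2v2) => ->; rewrite O1v1.
have fv2 : f v2 = v1 by rewrite /f eqxx (negPf n21).
have fO1 : {in O1 :\ v1, f =1 f1}.
  move=> x /setD1P[nx1 O1x]; rewrite /f (negPf nx1) O1x.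
  by case: eqP O1x => // ->; rewrite (negPf (disj _ O2v2)).
have fO2 : {in O2 :\ v2, f =1 f2}.
  move=> x /setD1P[nx2 O2x]; rewrite /f (negPf nx2) O2x (negPf (disj _ O2x)).
  by case: eqP O2x => // ->; move/disj; rewrite O1v1.
have fX : {in X :\: O1 :\: O2, f =1 f3}.
  move=> x /setDP[/setDP[_ O1x] O2x]; rewrite /f (negPf O1x) (negPf O2x).
  by case: eqP O1x => [->|_ _]; [rewrite O1v1 | case: eqP O2x => // ->; rewrite O2v2].
exists f => [x Xx | s Gs sf].
  have [-> | nx1] := eqVneq x v1; first by rewrite fv1 fv2 (subsetP sO2X).
  have [-> | nx2] := eqVneq x v2; first by rewrite fv2 fv1 Xv1 eq_sym.
  have [O1x | O1x] := boolP (x \in O1).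
    have Zx : x \in O1 :\ v1 by rewrite !inE nx1.
    have [Zfx nfx ffx] := f1M x Zx; rewrite !fO1 //; split=> //.
    by apply: (subsetP sO1X); case/setD1P: Zfx.
  have [O2x | O2x] := boolP (x \in O2).
    have Zx : x \in O2 :\ v2 by rewrite !inE nx2.
    have [Zfx nfx ffx] := f2M x Zx; rewrite !fO2 //; split=> //.
    by apply: (subsetP sO2X); case/setD1P: Zfx.
  have Zx : x \in X :\: O1 :\: O2 by rewrite !inE O1x O2x.
  have [Zfx nfx ffx] := f3M x Zx; rewrite !fX //; split=> //.
  by case/setDP: Zfx => /setDP[].
have sO1 x : (s x \in O1) = (x \in O1) by apply: (acts_act actO1 Gs).
have sv12 : f (s v1) = s v2 by rewrite sf // fv1.
(* [s v1] is a vertex of [O1] that [f] sends into [O2]. *)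
have sv1 : s v1 = v1.
  have [// | nsv1] := eqVneq (s v1) v1.
  have Zsv1 : s v1 \in O1 :\ v1 by rewrite !inE nsv1 sO1.
  have [/setD1P[_]] := f1M _ Zsv1.
  by rewrite -fO1 // sv12 sO1 (negPf (disj _ O2v2)).
have Ks : s \in K.
  by rewrite memK Gs -sv12 !sv1 fv1 !eqxx.
have sC (Z : {set T}) g : [acts K, on Z | 'P] -> Z \subset X -> {in Z, f =1 g} ->
    (forall t, t \in K -> {in Z, forall x, g (t x) = t (g x)} -> t \in 'C(Z | 'P)) ->
  s \in 'C(Z | 'P).
  move=> actZ sZX fg g_rigid; apply: g_rigid => // x Zx.
  have Zsx : s x \in Z by rewrite [s x \in Z](acts_act actZ Ks).
  by rewrite -!fg // sf // (subsetP sZX).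
have O1C := sC _ _ actK1 (subset_trans (subsetDl _ _) sO1X) fO1 f1_rigid.
have O2C := sC _ _ actK2 (subset_trans (subsetDl _ _) sO2X) fO2 f2_rigid.
have O3C := sC _ _ actK3 (subset_trans (subsetDl _ _) (subsetDl _ _)) fX f3_rigid.
apply/astabP => x Xx; have [-> // | nx1] := eqVneq x v1.
have [-> | nx2] := eqVneq x v2; first by rewrite /= /aperm -sv12 sv1.
have [O1x | O1x] := boolP (x \in O1).
  by apply: astab_act O1C _; rewrite !inE nx1.
have [O2x | O2x] := boolP (x \in O2).
  by apply: astab_act O2C _; rewrite !inE nx2.
by apply: astab_act O3C _; rewrite !inE O1x O2x.
Qed.

(** * Labeling a matching *)

(** The labeled class consists of the arcs that underlie the edges of the
    matching.  Each pair of matched vertices carries an arc in one direction,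
    so a permutation preserving the class must preserve [W] and commute
    with [f] there. *)
Lemma rho'_le_half_matching (T : tournament) (W : {set T}) (f : T -> T) :
    matching W f ->
    (forall s, s \in automorphisms T -> {in W, forall x, s x \in W} ->
      {in W, forall x, f (s x) = s (f x)} -> s = 1) ->
  (rho' T).*2 <= #|W|.
Proof.
move=> fM f_rigid.
pose phi : labeling T := [ffun e => ((val e).1 \in W) && (f (val e).1 == (val e).2)].
pose S := arc_class phi true.
have SP e : e \in S -> (val e).1 \in W /\ f (val e).1 = (val e).2.
  by rewrite inE ffunE eqb_id => /andP[We /eqP].
have phi_dist : distinguishing phi.
  apply/forallP => s; apply/implyP => /forallP s_phi; apply/eqP.
  have s_aut : val s \in automorphisms T by rewrite inE; apply: valP.
  have s_arc u v (uv : arc u v) : ((u \in W) && (f u == v)) =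
      ((val s u \in W) && (f (val s u) == val s v)).
    pose e : arcs T := exist (fun e : T * T => arc e.1 e.2) (u, v) uv.
    by have /eqP := s_phi e; rewrite !ffunE.
  have sW x : x \in W -> val s x \in W /\ f (val s x) = val s (f x).
    move=> Wx; have [Wfx nfx ffx] := fM x Wx.
    have [x_fx | fx_x] := boolP (arc x (f x)).
      by have := s_arc _ _ x_fx; rewrite Wx eqxx /= => /esym/andP[-> /eqP].
    have := s_arc (f x) x; rewrite (arcC (_ : x != f x)) 1?eq_sym // fx_x.
    move/(_ isT); rewrite Wfx ffx eqxx /= => /esym/andP[Wsfx /eqP eq_s].
    by have [? _ <-] := fM _ Wsfx; rewrite -eq_s.
  by apply: f_rigid => // x /sW[].
have rho_leS : rho' T <= #|S|.
  rewrite /rho'; case: ex_minnP => m _; apply.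
  apply/existsP; exists S; rewrite eqxx andbT; apply/existsP; exists phi.
  by rewrite phi_dist; apply/existsP; exists true.
rewrite (leq_trans (_ : _ <= #|S|.*2)) ?leq_double //.
pose tl (e : arcs T) := (val e).1; pose hd (e : arcs T) := (val e).2.
(* Tails and heads of the labeled arcs are the two ends of the edges, so they
   form disjoint copies of the class inside [W]. *)
have tl_inj : {in S &, injective tl}.
  move=> e e' /SP[_ eqe] /SP[_ eqe'] eq_tl; apply: val_inj.
  by rewrite [LHS]surjective_pairing [RHS]surjective_pairing -eqe -eqe' -/(tl e) eq_tl.
have f_hd e : e \in S -> f (hd e) = tl e.
  by rewrite /hd; case/SP=> We <-; have [] := fM _ We.
have hd_inj : {in S &, injective hd}.
  by move=> e e' Se Se' eq_hd; apply: tl_inj => //; rewrite -!f_hd ?eq_hd.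
rewrite -addnn -{1}(card_in_imset tl_inj) -(card_in_imset hd_inj) -cardsUI.
have -> : (tl @: S) :&: (hd @: S) = set0.
  apply/setP => u; rewrite inE [RHS]inE; apply/andP.
  case=> /imsetP[e Se ->] /imsetP[e' Se' eq_u].
  have := f_hd _ Se'; rewrite -eq_u; have [_ ->] := SP _ Se => eq_v.
  have := valP e; have := valP e'; rewrite -/(hd e') -/(tl e') -eq_v -eq_u -/(tl e).
  rewrite /= -/(tl e) -/(hd e) => a1 a2.
  have ne : tl e != hd e by apply: contraTneq a2 => ->; rewrite arcxx.
  by rewrite (arcC ne) a2 in a1.
rewrite cards0 addn0 subset_leq_card // subUset.
apply/andP; split; apply/subsetP => _ /imsetP[e Se ->]; case: (SP e Se) => // We eq_f.
by rewrite /hd -eq_f; case: (fM _ We).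
Qed.

(** A base of at most a third of the vertices is completed to a set [W] of even
    order; a vertex is left for this because a third of a positive number is
    smaller than it.  A matching of [W] that is rigid for the setwise stabilizer
    of [W] then fixes [W], hence the base, hence everything. *)
Lemma double_rho'_le (T : tournament) : (rho' T).*2 <= (#|T| %/ 3).+1.
Proof.
have [|B leB] := @pinned_by_third T (automorphisms T) [set: T] (subxx _).
  by apply/actsP => s _ x; rewrite !inE.
rewrite subsetT cardsT /= in leB * => fixB.
have [W [sBW leW evW]] : exists W : {set T},
    [/\ B \subset W, #|W| <= (#|T| %/ 3).+1 & ~~ odd #|W|].
  have [oddB | evB] := boolP (odd #|B|); last by exists B; rewrite subxx evB ltnW.
  have /card_gt0P[u] : 0 < #|~: B|.
    rewrite -(ltn_add2l #|B|) addn0 cardsC (leq_ltn_trans leB) //.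
    by rewrite ltn_Pdiv // Defs.order_gt0.
  rewrite inE => Bu; exists (u |: B).
  by rewrite subsetUr cardsU1 Bu /= oddB.
have actW : [acts 'N_(automorphisms T)(W | 'P), on W | 'P] by apply: subsetIr.
have [f fM f_rigid] := rigid_matching (subsetIl _ _) actW evW.
have: (rho' T).*2 <= #|W|.
  apply: rho'_le_half_matching fM _ => s s_aut sW sf.
  have sNW : s \in 'N_(automorphisms T)(W | 'P).
    rewrite inE s_aut /= !inE /=.
    by apply/subsetP => x Wx; rewrite inE; apply: sW.
  have sCW := f_rigid s sNW sf.
  apply/permP => x; rewrite perm1; apply: (astab_act (subsetP fixB s _) (in_setT x)).
  by rewrite inE s_aut (subsetP (astabS _ sBW)).
by move/leq_trans; apply.
Qed.

Local Close Scope group_scope.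

Theorem theorem5 (T : tournament) (n : nat) (order_T : #|T| = n) :
  rho' T <= (7 * n) %/ 36 + 3.
Proof.
have := double_rho'_le T; rewrite order_T.
by move: (rho' T) => r; lia.
Qed.
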